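(* Let $K$ be a local field with absolute value $|\cdot|$, and let $E$ be an elliptic curve over $K$ defined by the Weierstrass equation $$y^2 + a_1xy + a_3y = x^3 + a_2x^2 + a_4x + a_6,$$ with associated quantities $b_2, b_4, b_6, b_8$. Suppose that $\Gamma$ is an open subgroup of $E(K)$ such that $x(P)$ does not take the value $0$ for $P\in\Gamma$. For $P\in\Gamma$ define sequences $(t_n)$, $(W_n)$, $(Z_n)$, $n\ge 0$, inductively by $$t_0=\frac{1}{x(P)},\qquad t_{n+1}=\frac{W_n}{Z_n},$$ where $$W_n = 4t_n + b_2t_n^2 + 2b_4t_n^3 + b_6t_n^4,\qquad Z_n = 1 - b_4t_n^2 - 2b_6t_n^3 - b_8t_n^4.$$ Then there are constants $\varepsilon>0$ and $M$, independent of $P\in\Gamma$, such that $$|t_n|\le M\quad\text{and}\quad |Z_n|\ge\varepsilon\quad\text{for all } n\ge 0$$ (in particular the sequences are well defined), and consequently there is a bound $N$ such that $\log|Z_n|\le N$ for all $n\ge 0$ and all $P\in\Gamma$. Put $$\mu(P)=\sum_{n=0}^{\infty}\frac{1}{4^n}\log|Z_n|\quad\text{and}\quad \lambda(P)=\frac12\log|x(P)|+\frac18\mu(P).$$ Then $\lambda$ is a function continuous on $\Gamma-\{0\}$, bounded outside of any neighborhood of $0$ in $\Gamma$, such that $$\lambda(P)-\frac12\log|x(P)|\to 0\quad\text{as } P\to 0,$$ and such that, for $P\in\Gamma$, $$\lambda(2P)=4\lambda(P)-\log|Y(P)|\quad\text{if } 2P\ne 0,\qquad\text{where } Y=2y+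a_1x+a_3.$$
   Context: The group $E(K)$ carries the topology induced by that of $K$, and $0$ denotes the identity element of $E(K)$, i.e. the point at infinity of the Weierstrass equation. The function $x$ has a double pole at $0$, so $1/x$ is understood to take the value $0$ at the point $0$; thus $t_0=0$ when $P=0$. The quantities $b_i$ are the usual ones: $$b_2=a_1^2+4a_2,\quad b_4=2a_4+a_1a_3,\quad b_6=a_3^2+4a_6,\quad b_8=a_1^2a_6+4a_2a_6-a_1a_3a_4+a_2a_3^2-a_4^2.$$ The sequences $t_n, W_n, Z_n$ depend on $P$. *)

(* Defs.v *)
From HB Require Import structures.
From mathcomp Require Import all_boot all_order all_algebra.
From mathcomp Require Import all_classical all_reals all_analysis.
From mathcomp Require Import ring.

Set Implicit Arguments.
Unset Strict Implicit.
Unset Printing Implicit Defensive.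

Import Order.TTheory GRing.Theory Num.Theory.
Import numFieldNormedType.Exports.

Local Open Scope classical_set_scope.
Local Open Scope ring_scope.

(* normedZmodType cannot be used for absolute values: its axiom
   `|x *+ n| = `|x| *+ n excludes the nonarchimedean ones. *)
Record absval (R : realType) (K : fieldType) := AbsVal {
  absv :> K -> R;
  absv_ge0 : forall x, 0 <= absv x;
  absv_eq0 : forall x, absv x = 0 <-> x = 0;
  absvM : forall x y, absv (x * y) = absv x * absv y;
  absvD : forall x y, absv (x + y) <= absv x + absv y
}.

(* The field K with the metric topology defined by the absolute value v. *)
Definition valued (R : realType) (K : fieldType) (v : absval R K) : Type := K.

Section ValuedMetric.
Variables (R : realType) (K : fieldType) (v : absval R K).

HB.instance Definition _ := Choice.copy (valued v) K.

Definition vdist (x y : valued v) : R := v ((x : K) - y).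

Lemma absv1 : v 1 = 1.
Proof.
have v1 : v 1 != 0 by apply/eqP => /absv_eq0/eqP; rewrite oner_eq0.
by apply: (mulfI v1); rewrite -absvM !mulr1.
Qed.

Lemma absvN (x : K) : v (- x) = v x.
Proof.
suff vN1 : v (-1) = 1 by rewrite -mulN1r absvM vN1 mul1r.
apply/eqP; rewrite -(@eqrXn2 _ 2) ?absv_ge0 //.
by rewrite expr2 -absvM mulrNN mulr1 absv1 expr1n.
Qed.

Lemma vdistxx (x : valued v) : vdist x x = 0.
Proof. by apply/absv_eq0; rewrite subrr. Qed.

Lemma vdist_eq0 (x y : valued v) : vdist x y = 0 -> x = y.
Proof. by move/absv_eq0/eqP; rewrite subr_eq0 => /eqP. Qed.

Lemma vdist_sym (x y : valued v) : vdist x y = vdist y x.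
Proof. by rewrite /vdist -absvN opprB. Qed.

Lemma vdist_triangle (y x z : valued v) : vdist x z <= vdist x y + vdist y z.
Proof.
by rewrite /vdist (_ : (x : K) - z = (x - y : K) + (y - z : K)) ?absvD // addrA subrK.
Qed.

HB.instance Definition _ := isMetric.Build R (valued v)
  vdistxx vdist_eq0 vdist_sym vdist_triangle.

End ValuedMetric.

(* Local fields, archimedean or not, are the fields that are locally compact
   for a nontrivial absolute value. *)
Definition local_field (R : realType) (K : fieldType) (v : absval R K) : Prop :=
  (exists2 x : K, x != 0 & v x != 1) /\ locally_compact [set: valued v].

Section WeierstrassCoefficients.
Variables (K : fieldType) (a1 a2 a3 a4 a6 : K).

Definition wb2 := a1 ^+ 2 + 4 * a2.
Definition wb4 := 2 * a4 + a1 * a3.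
Definition wb6 := a3 ^+ 2 + 4 * a6.
Definition wb8 := a1 ^+ 2 * a6 + 4 * a2 * a6 - a1 * a3 * a4
  + a2 * a3 ^+ 2 - a4 ^+ 2.
Definition wdisc := - (wb2 ^+ 2 * wb8) - 8 * wb4 ^+ 3 - 27 * wb6 ^+ 2
  + 9 * wb2 * wb4 * wb6.

End WeierstrassCoefficients.

Record ellcurve (K : fieldType) := EllCurve {
  a1 : K; a2 : K; a3 : K; a4 : K; a6 : K;
  wdisc_neq0 : wdisc a1 a2 a3 a4 a6 != 0
}.

Section EllipticCurve.
Variables (K : fieldType) (E : ellcurve K).

Definition b2 := wb2 (a1 E) (a2 E).
Definition b4 := wb4 (a1 E) (a3 E) (a4 E).
Definition b6 := wb6 (a3 E) (a6 E).
Definition b8 := wb8 (a1 E) (a2 E) (a3 E) (a4 E) (a6 E).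

(* None stands for the point at infinity. *)
Definition oncurve (P : option (K * K)) : bool :=
  if P is Some (x, y) then
    y ^+ 2 + a1 E * x * y + a3 E * y
      == x ^+ 3 + a2 E * x ^+ 2 + a4 E * x + a6 E
  else true.

Record point := Point { coords : option (K * K); coordsP : oncurve coords }.

HB.instance Definition _ := [isSub for coords].
HB.instance Definition _ := [Choice of point by <:].

Definition ptO : point := @Point None isT.

Definition opp_coords (P : option (K * K)) : option (K * K) :=
  if P is Some (x, y) then Some (x, - y - a1 E * x - a3 E) else None.

(* Slope of the line through two points of the curve; when x1 = x2 this is only
   used for equal points, and is then the slope of the tangent. *)
Definition chord_slope (x1 y1 x2 y2 : K) : K :=
  if x1 == x2 then
    (3 * x1 ^+ 2 + 2 * a2 E * x1 + a4 E - a1 E * y1)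
      / (2 * y1 + a1 E * x1 + a3 E)
  else (y2 - y1) / (x2 - x1).

Definition add_coords (P Q : option (K * K)) : option (K * K) :=
  match P, Q with
  | None, _ => Q
  | _, None => P
  | Some (x1, y1), Some (x2, y2) =>
    if (x1 == x2) && (y1 + y2 + a1 E * x2 + a3 E == 0) then None
    else
      let s := chord_slope x1 y1 x2 y2 in
      let x3 := s ^+ 2 + a1 E * s - a2 E - x1 - x2 in
      Some (x3, - (s + a1 E) * x3 - (y1 - s * x1) - a3 E)
  end.

Lemma opp_oncurve P : oncurve P -> oncurve (opp_coords P).
Proof. by case: P => [[x y]|] //= /eqP h; apply/eqP; rewrite -h; ring. Qed.

Lemma add_oncurve P Q : oncurve P -> oncurve Q -> oncurve (add_coords P Q).
Proof.
case: P => [[x1 y1]|] //; case: Q => [[x2 y2]|] //= /eqP h1 /eqP h2.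
pose F x y := y ^+ 2 + a1 E * x * y + a3 E * y
  - (x ^+ 3 + a2 E * x ^+ 2 + a4 E * x + a6 E).
have F1 : F x1 y1 = 0 by rewrite /F h1 subrr.
have F2 : F x2 y2 = 0 by rewrite /F h2 subrr.
case: ifP => //= /negbT ne; rewrite /chord_slope.
rewrite -subr_eq0 -[X in X == 0]/(F _ _).
have [e|d] := eqVneq x1 x2.
  subst x2; move: ne; rewrite eqxx /= => ne.
  have /eqP : (y1 - y2) * (y1 + y2 + a1 E * x1 + a3 E) = 0.
    by transitivity (F x1 y1 - F x1 y2); [rewrite /F; ring | rewrite F1 F2 subrr].
  rewrite mulf_eq0 (negbTE ne) orbF subr_eq0 => /eqP ey; subst y2.
  set D := 2 * y1 + a1 E * x1 + a3 E.
  have D0 : D != 0 by move: ne; congr (_ != 0); rewrite /D; ring.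
  set T := 3 * x1 ^+ 2 + 2 * a2 E * x1 + a4 E - a1 E * y1.
  set s := T / D; have sD : T - s * D = 0 by rewrite /s divfK ?subrr.
  set x3 := s ^+ 2 + a1 E * s - a2 E - x1 - x1.
  apply/eqP; transitivity (F x1 y1 - (T - s * D) * (x3 - x1)).
    by rewrite /F /x3 /D /T; ring.
  by rewrite F1 sD mul0r subrr.
set s := (y2 - y1) / (x2 - x1).
have ey2 : y2 = y1 + s * (x2 - x1).
  by rewrite /s divfK ?subr_eq0 1?eq_sym // addrC subrK.
set x3 := s ^+ 2 + a1 E * s - a2 E - x1 - x2.
have d0 : x1 - x2 != 0 by rewrite subr_eq0.
apply/eqP; apply: (mulfI d0); rewrite mulr0.
transitivity (F x1 y1 * (x3 - x2) - F x2 y2 * (x3 - x1)).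
  by rewrite /F /x3 ey2; ring.
by rewrite F1 F2 !mul0r subrr.
Qed.

Definition pt_opp (P : point) : point := Point (opp_oncurve (coordsP P)).

Definition pt_add (P Q : point) : point :=
  Point (add_oncurve (coordsP P) (coordsP Q)).

Definition subgroup (G : set point) : Prop :=
  [/\ G ptO, forall P Q, G P -> G Q -> G (pt_add P Q)
    & forall P, G P -> G (pt_opp P)].

(* Both have the junk value 0 at ptO, where x and Y have poles. *)
Definition xcoord (P : point) : K := if coords P is Some (x, y) then x else 0.
Definition Ycoord (P : point) : K :=
  if coords P is Some (x, y) then 2 * y + a1 E * x + a3 E else 0.

(* 1 / x, extended by 0 at its double zero ptO. *)
Definition inv_x (P : point) : K := if coords P is Some (x, y) then x^-1 else 0.

Definition Wpoly (t : K) : K :=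
  4 * t + b2 * t ^+ 2 + 2 * b4 * t ^+ 3 + b6 * t ^+ 4.
Definition Zpoly (t : K) : K :=
  1 - b4 * t ^+ 2 - 2 * b6 * t ^+ 3 - b8 * t ^+ 4.

Fixpoint tseq (P : point) (n : nat) : K :=
  if n is m.+1 then Wpoly (tseq P m) / Zpoly (tseq P m) else inv_x P.
Definition Wseq (P : point) (n : nat) : K := Wpoly (tseq P n).
Definition Zseq (P : point) (n : nat) : K := Zpoly (tseq P n).

(* Homogeneous coordinates in the projective plane. *)
Definition hcoords (P : point) : K * K * K :=
  if coords P is Some (x, y) then (x, y, 1) else (0, 1, 0).

End EllipticCurve.

Section PointTopology.
Variables (R : realType) (K : fieldType) (v : absval R K) (E : ellcurve K).

(* E(K) with the topology induced by that of (K, v). *)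
Definition vpoint : Type := (let _ := v in point E).

HB.instance Definition _ := Choice.copy vpoint (point E).

(* The subspace topology of the projective plane, itself a quotient of
   K^3 - {0}: the open sets are the traces of the open subsets of K^3 that
   are stable under scaling by nonzero elements of K. *)
Definition scale_stable (V : set (valued v * valued v * valued v)) : Prop :=
  forall (c X Y Z : K), c != 0 -> V (X, Y, Z) -> V (c * X, c * Y, c * Z).

Definition pt_open (U : set vpoint) : Prop :=
  exists V : set (valued v * valued v * valued v),
    [/\ open V, scale_stable V & U = [set P | V (@hcoords K E P)]].

Lemma pt_openT : pt_open setT.
Proof. by exists setT; split => //; exact: openT. Qed.

Lemma pt_openI : setI_closed pt_open.
Proof.
move=> _ _ [V [oV sV ->]] [W [oW sW ->]]; exists (V `&` W); split => //.
  exact: openI.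
by move=> c X Y Z c0 [VX WX]; split; [exact: sV | exact: sW].
Qed.

Lemma pt_open_bigU (I : Type) (f : I -> set vpoint) :
  (forall i, pt_open (f i)) -> pt_open (\bigcup_i f i).
Proof.
move=> /choice[V VP]; exists (\bigcup_i V i); split.
- by apply: bigcup_open => i _; have [] := VP i.
- move=> c X Y Z c0 [i _ ViX]; exists i => //.
  by have [_ sV _] := VP i; exact: sV.
- apply/seteqP; split=> P [i _ fiP]; exists i => //; have [_ _ fE] := VP i.
    by move: fiP; rewrite fE.
  by rewrite fE.
Qed.

HB.instance Definition _ := isOpenTopological.Build vpoint
  pt_openT pt_openI pt_open_bigU.

End PointTopology.

Section LocalHeight.
Variables (R : realType) (K : fieldType) (v : absval R K) (E : ellcurve K).

Definition mu_term (P : vpoint v E) (n : nat) : R := ln (v (Zseq P n)) / 4 ^+ n.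

Definition mu (P : vpoint v E) : R := limn (series (mu_term P)).

(* Only meaningful for P != ptO. *)
Definition lambda (P : vpoint v E) : R :=
  ln (v (xcoord P)) / 2 + mu P / 8.

End LocalHeight.

(* Main.v *)
Require Import Defs.
From mathcomp Require Import all_boot all_order all_algebra.
From mathcomp Require Import all_classical all_reals all_analysis.
From mathcomp Require Import ring lra.

Set Implicit Arguments.
Unset Strict Implicit.
Unset Printing Implicit Defensive.

Import Order.TTheory GRing.Theory Num.Theory.
Import numFieldNormedType.Exports.
Local Open Scope classical_set_scope.
Local Open Scope ring_scope.

(** Put [t = 1 / x], a function on the curve that vanishes at infinity. The
    duplication formula is [t(2P) = W(t) / Z(t)] (inv_x_double), so that [t_n] is
    the value of [t] at [2 ^ n P], again a point of [Gamma]. Everything rests on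
    bounds for [t] and [1 / Z] on [Gamma] (inv_x_bounded, Zpoly_lower_bound).

    The function [t] is bounded because an open subgroup is closed. Indeed, if
    points [P] of [Gamma] had [x(P)] tending to 0, their [y]-coordinates would
    be bounded, and by local compactness of [K] a subsequence would tend to a point
    [Q] of the curve with [x(Q) = 0]. Then [Q - P] would tend to 0, as the chord
    through [Q] and [- P] becomes vertical (slope_infty), and would lie in the open
    set [Gamma]; so would [Q = (Q - P) + P], against the hypothesis on [Gamma].

    Let [|t| <= M] on [Gamma]. As [W / Z] is again a value of [t], one has
    [|W| <= M |Z|]; a Bezout identity between [W] and [Z] with a multiple of the
    discriminant as right hand side (bezout_WZ) then keeps [Z] away from 0.

    Consequently [log |Z_n|] is bounded uniformly on [Gamma], and the series [mu] is
    dominated by a geometric one: it converges uniformly, its sum is bounded and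
    continuous (mu_continuous), and it vanishes at infinity, where all [t_n] are 0.
    This gives the continuity, boundedness and limit statements on [lambda]. The
    functional equation follows from the shift [mu(2P) = 4 (mu(P) - log |Z_0|)]
    (mu_double) and the identity [W(1 / x) = Y ^ 2 / x ^ 4] (Wpoly_invx). *)

(** * Duplication on the curve *)

(** Away from [t = 0] this keeps [W] and [Z] from being small together; near
    [t = 0], where the right hand side degenerates, [Z] is close to 1. The
    cofactors come from eliminating [x] between the numerator and the denominator
    of [x(2P)]. *)
Lemma bezout_WZ (K : fieldType) (E : ellcurve K) (t : K) :
  t * (48 + 8 * b2 E * t + (32 * b4 E - b2 E ^+ 2) * t ^+ 2) * Zpoly E t
    - (12 - b2 E * t - 10 * b4 E * t ^+ 2
       + (b2 E * b4 E - 27 * b6 E) * t ^+ 3) * Wpoly E t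
  = - wdisc (a1 E) (a2 E) (a3 E) (a4 E) (a6 E) * t ^+ 7.
Proof.
rewrite /Zpoly /Wpoly /wdisc /b2 /b4 /b6 /b8 /wb2 /wb4 /wb6 /wb8; ring.
Qed.

Lemma WZ_coprime (K : fieldType) (E : ellcurve K) (t : K) :
  Wpoly E t = 0 -> Zpoly E t != 0.
Proof.
move=> W0; apply/eqP => Z0; have := bezout_WZ E t.
rewrite W0 Z0 !mulr0 subrr => /esym/eqP.
rewrite mulf_eq0 oppr_eq0 (negbTE (wdisc_neq0 E)) /= expf_eq0 /= => /eqP t0.
by move: Z0; rewrite t0 /Zpoly !expr0n /= !mulr0 !subr0 => /eqP; rewrite oner_eq0.
Qed.

Lemma Ycoord_sqr (K : fieldType) (E : ellcurve K) (x y : K) :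
  oncurve E (Some (x, y)) ->
  (2 * y + a1 E * x + a3 E) ^+ 2
  = 4 * x ^+ 3 + b2 E * x ^+ 2 + 2 * b4 E * x + b6 E.
Proof.
move=> /eqP h; rewrite /b2 /b4 /b6 /wb2 /wb4 /wb6.
transitivity (4 * (y ^+ 2 + a1 E * x * y + a3 E * y) + (a1 E * x + a3 E) ^+ 2).
  by ring.
by rewrite h; ring.
Qed.

Lemma Wpoly_invx (K : fieldType) (E : ellcurve K) (x y : K) :
  oncurve E (Some (x, y)) -> x != 0 ->
  Wpoly E x^-1 = (2 * y + a1 E * x + a3 E) ^+ 2 / x ^+ 4.
Proof.
move=> h x0; rewrite (Ycoord_sqr h) /Wpoly.
by field.
Qed.

Lemma double_coords (K : fieldType) (E : ellcurve K) (P : Defs.point E) (x y : K) :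
  coords P = Some (x, y) -> x != 0 ->
  if 2 * y + a1 E * x + a3 E == 0 then pt_add P P = ptO E
  else exists z, coords (pt_add P P)
    = Some (x ^+ 4 * Zpoly E x^-1 / (2 * y + a1 E * x + a3 E) ^+ 2, z).
Proof.
case: P => [c hP] /= ec x0; subst c.
have eY : y + y + a1 E * x + a3 E = 2 * y + a1 E * x + a3 E by ring.
case: ifP => [Y0|/negbT Y0].
  by apply/val_inj; rewrite /= eqxx eY Y0.
rewrite /= eqxx eY (negbTE Y0) /=.
set xx := _ - x - x; eexists; congr (Some (_, _)).
rewrite /xx /chord_slope eqxx /Zpoly.
have /eqP h := hP.
set Y := 2 * y + a1 E * x + a3 E in Y0 *.
set T := 3 * x ^+ 2 + 2 * a2 E * x + a4 E - a1 E * y.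
apply: (mulIf (expf_neq0 2 Y0)); rewrite divfK ?expf_neq0 //.
transitivity (T ^+ 2 + a1 E * T * Y - (a2 E + 2 * x) * Y ^+ 2).
  by field.
transitivity (x ^+ 4 - b4 E * x ^+ 2 - 2 * b6 E * x - b8 E); last by field.
rewrite (Ycoord_sqr hP).
have eT : T ^+ 2 + a1 E * T * Y = (3 * x ^+ 2 + 2 * a2 E * x + a4 E) ^+ 2
   + a1 E * (3 * x ^+ 2 + 2 * a2 E * x + a4 E) * (a1 E * x + a3 E)
   - a1 E ^+ 2 * (y ^+ 2 + a1 E * x * y + a3 E * y).
  by rewrite /T /Y; ring.
by rewrite eT h /b2 /b4 /b6 /b8 /wb2 /wb4 /wb6 /wb8; ring.
Qed.

(** Read in [t = 1 / x], the duplication formula is [t(2P) = W(t) / Z(t)]. It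
    forces [Z(t) != 0]: since [W] and [Z] have no common zero, [Z(t) = 0] would
    give [2P != 0] and [x(2P) = 0]. *)
Lemma inv_x_double (K : fieldType) (E : ellcurve K) (P : Defs.point E) :
  (P != ptO E -> xcoord P != 0) ->
  (pt_add P P != ptO E -> xcoord (pt_add P P) != 0) ->
  Zpoly E (inv_x P) != 0 /\
  inv_x (pt_add P P) = Wpoly E (inv_x P) / Zpoly E (inv_x P).
Proof.
case: (boolP (P == ptO E)) => [/eqP -> _ _|Pn /(_ isT) xP xPP].
  rewrite /inv_x /= /Zpoly /Wpoly !expr0n /= !mulr0 !addr0 !subr0 mul0r.
  by rewrite oner_eq0.
case cP : (coords P) => [[x y]|]; last first.
  by move: Pn; rewrite -(inj_eq val_inj) /= cP eqxx.
rewrite /xcoord cP in xP.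
have := double_coords cP xP.
have -> : inv_x P = x^-1 by rewrite /inv_x cP.
have hP : oncurve E (Some (x, y)) by rewrite -cP; exact: coordsP.
have := Wpoly_invx hP xP.
case: ifP => [/eqP Y0|/negbT Y0] W.
  move=> ->; rewrite Y0 expr0n mul0r in W.
  by split; [exact: WZ_coprime | rewrite W mul0r].
case=> z cPP.
have nz : x ^+ 4 * Zpoly E x^-1 / (2 * y + a1 E * x + a3 E) ^+ 2 != 0.
  move: xPP; rewrite /xcoord cPP; apply.
  by apply/eqP => e; rewrite e in cPP.
have Z0 : Zpoly E x^-1 != 0.
  by apply: contraNneq nz => ->; rewrite mulr0 mul0r.
split=> //; rewrite /inv_x cPP W; field.
by rewrite xP Z0 Y0.
Qed.

(** An instance of associativity, [(Q - P) + P = Q]: [s] is the slope of the line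
    through [Q] and [- P], and the opposite of that line, of slope [- s - a1], meets
    the curve in [R], [P] and [- Q]. *)
Lemma add_recover (K : fieldType) (E : ellcurve K) (P Q : Defs.point E) (x y y0 : K) :
  coords P = Some (x, y) -> coords Q = Some (0, y0) -> x != 0 ->
  let s := (- y - a1 E * x - a3 E - y0) / x in
  let u := s ^+ 2 + a1 E * s - a2 E - x in
  let R := pt_add Q (pt_opp P) in
  [/\ xcoord R = u, R != ptO E & u != x -> pt_add R P = Q].
Proof.
case: P => [cP hP] /= eP; subst cP; case: Q => [cQ hQ] /= eQ; subst cQ => x0.
set R := pt_add _ _.
set s := _ / x; set u := s ^+ 2 + _ - _ - x.
have cR : coords R = Some (u, - (s + a1 E) * u - (y0 - s * 0) - a3 E).
  rewrite /R /= (eq_sym 0 x) (negbTE x0) /= /chord_slope eq_sym (negbTE x0).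
  by rewrite subr0 -/s subr0.
split; first by rewrite /xcoord cR.
  by apply/eqP => e; rewrite e in cR.
move=> ux; clearbody R; apply/val_inj; rewrite /= cR /= (negbTE ux) /= /chord_slope (negbTE ux).
have ux' : x - u != 0 by rewrite subr_eq0 eq_sym.
have -> : (y - (- (s + a1 E) * u - (y0 - s * 0) - a3 E)) / (x - u) = - (s + a1 E).
  apply: (mulIf ux'); rewrite divfK //.
  have -> : y = - (s * x) - y0 - a1 E * x - a3 E by rewrite /s divfK //; ring.
  by ring.
have -> : (- (s + a1 E)) ^+ 2 + a1 E * - (s + a1 E) - a2 E - u - x = 0.
  by rewrite /u; ring.
by congr (Some (_, _)); ring.
Qed.

(** A rational point with [x = 0] where both partial derivatives of the
    Weierstrass equation vanish would be a singular point of the curve. *)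
Lemma nonsingular_x0 (K : fieldType) (E : ellcurve K) (y0 : K) :
  oncurve E (Some (0, y0)) -> 2 * y0 + a3 E = 0 -> a4 E - a1 E * y0 != 0.
Proof.
move=> /eqP; rewrite !expr0n /= !mulr0 mul0r !addr0 !add0r => h Y0.
apply/eqP => /eqP; rewrite subr_eq0 => /eqP e4.
have e3 : a3 E = - (2 * y0) by apply/eqP; rewrite -addr_eq0 addrC Y0.
move: (wdisc_neq0 E); rewrite /wdisc /wb2 /wb4 /wb6 /wb8 -h e4 e3.
by apply/negP; rewrite negbK; apply/eqP; ring.
Qed.

(** * Limits with respect to an absolute value *)

Lemma absv0 (R : realType) (K : fieldType) (v : absval R K) : v 0 = 0.
Proof. exact/absv_eq0. Qed.

Lemma absv_gt0 (R : realType) (K : fieldType) (v : absval R K) (x : K) :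
  (0 < v x) = (x != 0).
Proof.
rewrite lt_neqAle absv_ge0 andbT eq_sym; congr (~~ _).
by apply/eqP/eqP; [move/absv_eq0 | move=> ->; exact: absv0].
Qed.

Lemma absvB (R : realType) (K : fieldType) (v : absval R K) (x y : K) :
  v (x - y) <= v x + v y.
Proof. by rewrite -(absvN v y) absvD. Qed.

Lemma absvX (R : realType) (K : fieldType) (v : absval R K) (x : K) (n : nat) :
  v (x ^+ n) = v x ^+ n.
Proof. by elim: n => [|n IH]; rewrite ?expr0 ?absv1 // !exprS absvM IH. Qed.

Lemma absvV (R : realType) (K : fieldType) (v : absval R K) (x : K) :
  v x^-1 = (v x)^-1.
Proof.
have [->|x0] := eqVneq x 0; first by rewrite invr0 absv0 invr0.
have vx : v x != 0 by rewrite gt_eqF // absv_gt0.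
by apply: (mulfI vx); rewrite -absvM !divff ?absv1.
Qed.

Lemma absv_dist (R : realType) (K : fieldType) (v : absval R K) (x y : K) :
  `|v x - v y| <= v (x - y).
Proof.
rewrite ler_norml; apply/andP; split.
  have := absvD v (y - x) x; rewrite subrK -(absvN v (y - x)) opprB; lra.
by have := absvD v (x - y) y; rewrite subrK; lra.
Qed.

(** Convergence in [K] expressed by real limits, for functions with values in the
    field itself, so that field operations apply to them directly. *)
Definition vcvg (R : realType) (K : fieldType) (v : absval R K) (T : Type)
    (F : set_system T) (f : T -> K) (a : K) : Prop :=
  v (f x - a) @[x --> F] --> (0 : R).

Lemma vcvgP (R : realType) (K : fieldType) (v : absval R K) (T : Type)
    (F : set_system T) {FF : Filter F} (f : T -> K) (a : K) :
  vcvg v F f a <->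
  forall e, 0 < e -> \forall x \near F, v (f x - a) < e.
Proof.
split=> [/cvgrPdist_lt h e /h|h]; last apply/cvgrPdist_lt => e /h.
  by apply: filterS => x; rewrite sub0r normrN ger0_norm // absv_ge0.
by apply: filterS => x; rewrite sub0r normrN ger0_norm // absv_ge0.
Qed.

Lemma vcvg_le (R : realType) (K : fieldType) (v : absval R K) (T : Type)
    (F : set_system T) {FF : Filter F} (f : T -> K) (a : K) (h : T -> R) :
  (forall x, v (f x - a) <= h x) -> h @ F --> (0 : R) -> vcvg v F f a.
Proof.
move=> fh h0; apply: (@squeeze_cvgr _ _ _ _ (fun=> 0) h) => //.
  by apply: nearW => x; rewrite absv_ge0 fh.
exact: cvg_cst.
Qed.

Lemma vcvg_cst (R : realType) (K : fieldType) (v : absval R K) (T : Type)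
    (F : set_system T) {FF : Filter F} (a : K) :
  vcvg v F (fun=> a) a.
Proof. by apply/vcvgP => e e0; apply: nearW => x; rewrite subrr absv0. Qed.

Lemma vcvg_absv (R : realType) (K : fieldType) (v : absval R K) (T : Type)
    (F : set_system T) {FF : Filter F} (f : T -> K) (a : K) :
  vcvg v F f a -> v (f x) @[x --> F] --> v a.
Proof.
move=> /vcvgP h; apply/cvgrPdist_lt => e /h.
by apply: filterS => x; apply: le_lt_trans; rewrite distrC absv_dist.
Qed.

Lemma vcvgD (R : realType) (K : fieldType) (v : absval R K) (T : Type)
    (F : set_system T) {FF : Filter F} (f g : T -> K) (a b : K) :
  vcvg v F f a -> vcvg v F g b ->
  vcvg v F (fun x => f x + g x) (a + b).
Proof.
move=> fa gb; apply: (@vcvg_le _ _ _ _ _ _ _ _ (fun x => v (f x - a) + v (g x - b))).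
  by move=> x; rewrite (_ : _ - _ = (f x - a) + (g x - b)) ?absvD //; ring.
by rewrite -[X in _ --> X](addr0 (0 : R)); exact: cvgD.
Qed.

Lemma vcvgN (R : realType) (K : fieldType) (v : absval R K) (T : Type)
    (F : set_system T) {FF : Filter F} (f : T -> K) (a : K) :
  vcvg v F f a -> vcvg v F (fun x => - f x) (- a).
Proof.
move=> fa; apply: (@vcvg_le _ _ _ _ _ _ _ _ (fun x => v (f x - a))) => // x.
by rewrite -absvN opprB opprK addrC.
Qed.

Lemma vcvgM (R : realType) (K : fieldType) (v : absval R K) (T : Type)
    (F : set_system T) {FF : Filter F} (f g : T -> K) (a b : K) :
  vcvg v F f a -> vcvg v F g b ->
  vcvg v F (fun x => f x * g x) (a * b).
Proof.
move=> fa gb; apply: (@vcvg_le _ _ _ _ _ _ _ _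
  (fun x => v (f x) * v (g x - b) + v (f x - a) * v b)).
  move=> x; rewrite -!absvM.
  by rewrite (_ : _ - _ = f x * (g x - b) + (f x - a) * b) ?absvD //; ring.
rewrite (_ : 0 = v a * 0 + 0 * v b); last by rewrite mulr0 mul0r addr0.
by apply: cvgD; apply: cvgM => //; [exact: vcvg_absv | exact: cvg_cst].
Qed.

Lemma vcvgV (R : realType) (K : fieldType) (v : absval R K) (T : Type)
    (F : set_system T) {FF : Filter F} (f : T -> K) (a : K) :
  a != 0 -> vcvg v F f a -> vcvg v F (fun x => (f x)^-1) a^-1.
Proof.
move=> a0 fa; have va : v (f x) @[x --> F] --> v a by exact: vcvg_absv.
have va0 : 0 < v a by rewrite absv_gt0.
have lim0 : v (f x - a) * ((v (f x))^-1 * (v a)^-1) @[x --> F] --> (0 : R).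
  rewrite -[X in _ --> X](mul0r ((v a)^-1 * (v a)^-1)).
  apply: cvgM => //; apply: cvgM; last exact: cvg_cst.
  by apply: cvgV => //; rewrite gt_eqF.
apply: (@squeeze_cvgr _ _ _ _ (fun=> 0) _ _ _ _ _ lim0); last exact: cvg_cst.
have : \forall x \near F, 0 < v (f x) by exact: (cvgr_gt (v a)).
apply: filterS => x; rewrite absv_gt0 => fx; rewrite absv_ge0 /=.
rewrite -!absvV -!absvM -(absvN v) le_eqVlt; apply/orP; left; apply/eqP.
by congr (v _); field; rewrite fx a0.
Qed.

Lemma vcvg_horner (R : realType) (K : fieldType) (v : absval R K) (T : Type)
    (F : set_system T) {FF : Filter F} (f : T -> K) (a : K) (p : {poly K}) :
  vcvg v F f a -> vcvg v F (fun x => p.[f x]) p.[a].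
Proof.
move=> fa; elim/poly_ind: p => [|p c IH].
  by under eq_fun do rewrite horner0; rewrite horner0; exact: vcvg_cst.
under eq_fun do rewrite hornerMXaddC; rewrite hornerMXaddC.
by apply: vcvgD; [exact: vcvgM | exact: vcvg_cst].
Qed.

Lemma vcvg_unique (R : realType) (K : fieldType) (v : absval R K) (T : Type)
    (F : set_system T) {FF : ProperFilter F} (f : T -> K) (a b : K) :
  vcvg v F f a -> vcvg v F f b -> a = b.
Proof.
move=> fa fb; apply/eqP; rewrite -subr_eq0; apply/eqP/(absv_eq0 v).
have h : v (f x - f x) @[x --> F] --> v (a - b).
  by apply: vcvg_absv; apply: vcvgD fa _; exact: vcvgN.
have h0 : v (f x - f x) @[x --> F] --> (0 : R).
  by under eq_fun do rewrite subrr absv0; exact: cvg_cst.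
exact: (cvg_unique _ h h0).
Qed.

(** If [r] tends to 0 while [s * r] has a nonzero limit, then [s] tends to
    infinity; this reaches the slope of a chord without dividing. *)
Lemma vcvg_infty (R : realType) (K : fieldType) (v : absval R K) (T : Type)
    (F : set_system T) {FF : Filter F} (r s : T -> K) (d : K) :
  d != 0 -> vcvg v F r 0 -> vcvg v F (fun x => s x * r x) d ->
  forall C, \forall x \near F, C < v (s x).
Proof.
move=> d0 /vcvgP r0 /vcvg_absv sr C.
have vd : 0 < v d by rewrite absv_gt0.
have C1 : 0 < `|C| + 1 by rewrite ltr_wpDl.
have /r0 hr : 0 < v d / 2 / (`|C| + 1) by rewrite !divr_gt0.
have : v d / 2 < v d by lra.
move=> /(cvgr_gt (v d) sr) hs; near=> x.
have : v d / 2 < v (s x * r x) by near: x.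
have : v (r x - 0) < v d / 2 / (`|C| + 1) by near: x.
rewrite subr0 ltr_pdivlMr // absvM => h1 h2; rewrite ltNge; apply/negP => h3.
have := lt_trans h1 h2; rewrite mulrC ltNge => /negP; apply.
by rewrite ler_wpM2r ?absv_ge0 // (le_trans h3) // (le_trans (ler_norm C)) ?lerDl.
Unshelve. all: by end_near. Qed.

(** Stated for functions that agree with a polynomial, so that the bound applies
    to explicit expressions. *)
Lemma horner_bounded (R : realType) (K : fieldType) (v : absval R K)
    (p : {poly K}) (f : K -> K) (M : R) :
  horner p =1 f -> exists B : R, forall t, v t <= M -> v (f t) <= B.
Proof.
move=> pf; have [B hB] : exists B : R, forall t, v t <= M -> v p.[t] <= B.
  elim/poly_ind: p {pf} => [|p c [B IH]].
    by exists 0 => t _; rewrite horner0 absv0.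
  exists (B * M + v c) => t tM; rewrite hornerMXaddC (le_trans (absvD _ _ _)) //.
  by rewrite lerD2r absvM ler_pM ?absv_ge0 // IH.
by exists B => t; rewrite -pf; exact: hB.
Qed.

Lemma vnbhsP (R : realType) (K : fieldType) (v : absval R K) (x : valued v)
    (A : set (valued v)) :
  nbhs x A <-> exists2 e, 0 < e & forall y : K, v (y - x) < e -> A y.
Proof.
rewrite -nbhs_ballE; split=> -[e e0 h]; exists e => //.
  by move=> y yx; apply: h; rewrite ballEmdist /= -[mdist _ _]/(vdist _ _) vdist_sym.
move=> y; rewrite ballEmdist /= -[mdist _ _]/(vdist _ _) vdist_sym.
exact: h.
Qed.

Lemma vcvg_nbhs (R : realType) (K : fieldType) (v : absval R K) (T : Type)
    (F : set_system T) {FF : Filter F} (f : T -> K) (a : K) :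
  (f : T -> valued v) @ F --> (a : valued v) <-> vcvg v F f a.
Proof.
rewrite vcvgP; split=> [h e e0|h A /vnbhsP[e e0 eA]].
  by apply: (h [set y : valued v | v ((y : K) - a) < e]); apply/vnbhsP; exists e.
by move: (h e e0); apply: filterS => x /eA.
Qed.

(** Scaling by a small element of [K] carries any bounded sequence into a given
    compact neighbourhood of 0. *)
Lemma bolzano (R : realType) (K : fieldType) (v : absval R K)
    (Kloc : local_field v) (u : nat -> K) (r : R) :
  (forall n, v (u n) <= r) ->
  exists a : K, exists2 phi : nat -> nat,
    forall k, (k <= phi k)%N & vcvg v \oo (u \o phi) a.
Proof.
move=> ur; have [[x x0 x1] lc] := Kloc.
have [c c0 c1] : exists2 c, c != 0 & v c < 1.
  have [xlt|xgt|/eqP] := ltgtP (v x) 1; last by rewrite (negbTE x1).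
    by exists x.
  by exists x^-1; rewrite ?invr_eq0 // absvV invf_lt1 // absv_gt0.
have [U nU [Uc _]] := lc (0 : valued v) I.
have /vnbhsP[e e0 eU] : nbhs (0 : valued v) U.
  by move: nU; rewrite /within /=; apply: filterS => z; exact.
(* The scale at which the whole sequence enters the compact set [U]. *)
have [m mr] : exists m, r * v c ^+ m < e.
  have : geometric r (v c) n @[n --> \oo] --> 0.
    by apply: cvg_geometric; rewrite ger0_norm ?absv_ge0.
  by move/cvgr_lt => /(_ e e0) [m _ /(_ m (leqnn m))] /=; exists m.
pose w n : valued v := u n * c ^+ m.
have wU : (w @ \oo) U.
  exists 0%N => // n _; apply: eU; rewrite subr0 absvM absvX (le_lt_trans _ mr) //.
  by rewrite ler_wpM2r ?exprn_ge0 ?absv_ge0.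
have [a' [_ cl]] := Uc _ _ wU.
have /choice[phi phiP] : forall k, exists n, (k <= n)%N /\ v ((w n : K) - a') < k.+1%:R^-1.
  move=> k; have := cl [set w n | n in [set n | (k <= n)%N]]
    [set y : valued v | v ((y : K) - a') < k.+1%:R^-1].
  case.
  - by exists k => // n /= kn; exists n.
  - by apply/vnbhsP; exists k.+1%:R^-1 => //; rewrite invr_gt0.
  - by move=> _ [[n /= kn <-] h]; exists n.
have cm0 : c ^+ m != 0 by rewrite expf_neq0.
exists ((a' : K) / c ^+ m), phi => [k|]; first by have [] := phiP k.
have -> : u \o phi = fun k => (w (phi k) : K) * (c ^+ m)^-1.
  by apply/funext => k /=; rewrite /w mulfK.
apply: vcvgM; last exact: vcvg_cst.
apply: (@squeeze_cvgr _ _ _ _ (fun=> 0) harmonic) => //.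
- by apply: nearW => k; rewrite absv_ge0 /= ltW //; have [] := phiP k.
- exact: cvg_cst.
- exact: cvg_harmonic.
Qed.

Lemma vcvgX (R : realType) (K : fieldType) (v : absval R K) (T : Type)
    (F : set_system T) {FF : Filter F} (f : T -> K) (a : K) (n : nat) :
  vcvg v F f a -> vcvg v F (fun x => f x ^+ n) (a ^+ n).
Proof.
move=> fa; rewrite -hornerXn; under eq_fun do rewrite -hornerXn.
exact: vcvg_horner.
Qed.

(** * The topology of the curve *)

Lemma open_vlt (R : realType) (K : fieldType) (v : absval R K)
    (T : topologicalType) (f g : T -> K) (d : R) :
  (forall p, vcvg v (nbhs p) f (f p)) -> (forall p, vcvg v (nbhs p) g (g p)) ->
  open [set p | v (f p) < d * v (g p)].
Proof.
move=> cf cg; have c : continuous (fun p => d * v (g p) - v (f p)).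
  move=> p; apply: cvgB; last exact: (vcvg_absv (cf p)).
  by apply: cvgM; [exact: cvg_cst | exact: (vcvg_absv (cg p))].
rewrite (_ : [set p | _] = (fun p => d * v (g p) - v (f p)) @^-1` [set x | 0 < x]).
  by apply: open_comp => [p _|]; [exact: c | exact: open_gt].
by apply/seteqP; split=> p /=; rewrite subr_gt0.
Qed.

Lemma vcvg_hcoords (R : realType) (K : fieldType) (v : absval R K)
    (p : valued v * valued v * valued v) :
  [/\ vcvg v (nbhs p) (fun q => q.1.1) p.1.1,
      vcvg v (nbhs p) (fun q => q.1.2) p.1.2
    & vcvg v (nbhs p) (fun q => q.2) p.2].
Proof.
split; apply/vcvg_nbhs.
- by apply: (cvg_comp _ _ cvg_fst cvg_fst).
- by apply: (cvg_comp _ _ cvg_fst cvg_snd).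
- exact: cvg_snd.
Qed.

Lemma nbhs_vpoint (R : realType) (K : fieldType) (v : absval R K)
    (E : ellcurve K) (V : set (valued v * valued v * valued v)) (P : vpoint v E) :
  open V -> scale_stable V -> V (@hcoords K E P) ->
  \forall Q \near P, V (@hcoords K E Q).
Proof.
move=> oV sV VP; apply: (@open_nbhs_nbhs _ P [set Q | V (@hcoords K E Q)]).
by split=> //; exists V.
Qed.

(** The Weierstrass equation is monic in [y]. *)
Lemma y_bounded (R : realType) (K : fieldType) (v : absval R K)
    (E : ellcurve K) (B : R) :
  exists C : R, forall x y,
    oncurve E (Some (x, y)) -> v x <= B -> v y <= C.
Proof.
have [C1 h1] : exists C1, forall x, v x <= B -> v (a1 E * x + a3 E) <= C1.
  by apply: (@horner_bounded _ _ v ((a1 E)%:P * 'X + (a3 E)%:P)) => x; rewrite !hornerE.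
have [C2 h2] : exists C2, forall x, v x <= B ->
    v (x ^+ 3 + a2 E * x ^+ 2 + a4 E * x + a6 E) <= C2.
  apply: (@horner_bounded _ _ v ('X^3 + (a2 E)%:P * 'X^2 + (a4 E)%:P * 'X
    + (a6 E)%:P)) => x; by rewrite !hornerE.
exists (C1 + C2 + 1) => x y /eqP h xB.
set p := x ^+ 3 + _ + _ + _ in h; set q := a1 E * x + a3 E.
have e : y ^+ 2 = p - q * y by rewrite -h /q; ring.
have {h2} : v p <= C2 := h2 x xB; have {h1} : v q <= C1 := h1 x xB.
have : v y ^+ 2 <= v p + v q * v y by rewrite -absvX e -absvM absvB.
have := absv_ge0 v y; have := absv_ge0 v p; have := absv_ge0 v q.
move: (v y) (v p) (v q) => Y a b; nra.
Qed.

(** The function [1 / x] is continuous wherever [x] does not vanish. At a finite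
    point this is read off in homogeneous coordinates, without division; at
    infinity a bounded [x] would bound [y]. *)
Lemma inv_x_continuous (R : realType) (K : fieldType) (v : absval R K)
    (E : ellcurve K) (P : vpoint v E) :
  (P != ptO E -> xcoord P != 0) ->
  vcvg v (nbhs P) (@inv_x K E) (inv_x P).
Proof.
move=> xP; apply/vcvgP => d d0.
case cP : (coords (P : Defs.point E)) => [[x y]|].
  have x0 : x != 0.
    move: xP; rewrite /xcoord cP; apply; apply/eqP => e; by rewrite e in cP.
  (* The condition [|1 / x - 1 / x0| < d] cleared of denominators; it excludes
     the point at infinity, where it reads [0 < 0]. *)
  pose V : set (valued v * valued v * valued v) :=
    [set q | v ((q.2 : K) - x^-1 * (q.1.1 : K)) < d * v (q.1.1 : K)].
  have oV : open V.
    apply: open_vlt => q; have [h1 h2 h3] := vcvg_hcoords q => //.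
    by apply: vcvgD => //; apply: vcvgN; apply: vcvgM => //; exact: vcvg_cst.
  have sV : scale_stable V.
    move=> c X Y Z c0; rewrite /V /=.
    rewrite (_ : c * Z - x^-1 * (c * X) = c * (Z - x^-1 * X)); last by ring.
    by rewrite !absvM mulrCA ltr_pM2l // absv_gt0.
  have nV : \forall Q \near P, V (@hcoords K E Q).
    apply: nbhs_vpoint => //; rewrite /hcoords cP /V /= mulVf // subrr absv0.
    by rewrite mulr_gt0 // absv_gt0.
  have -> : inv_x (P : Defs.point E) = x^-1 by rewrite /inv_x cP.
  apply: filterS nV => Q; rewrite /V /inv_x /hcoords.
  case: (coords (Q : Defs.point E)) => [[x' y']|] /=; last first.
    by rewrite absv0 mulr0 mulr0 subr0 absv0 ltxx.
  have [->|x'0] := eqVneq x' 0.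
    by rewrite absv0 mulr0 mulr0 subr0 absv1 ltr10.
  rewrite -ltr_pdivrMr ?absv_gt0 // -absvV -absvM.
  by rewrite (_ : (1 - x^-1 * x') / x' = x'^-1 - x^-1) //; field; rewrite x0.
have -> : inv_x (P : Defs.point E) = 0 by rewrite /inv_x cP.
have [C CP] := y_bounded v E d^-1.
pose e := (`|C| + 1)^-1.
have e0 : 0 < e by rewrite invr_gt0 ltr_wpDl.
pose V : set (valued v * valued v * valued v) :=
  [set q | v (q.2 : K) < e * v (q.1.2 : K)].
have oV : open V.
  by apply: open_vlt => q; have [h1 h2 h3] := vcvg_hcoords q.
have sV : scale_stable V.
  by move=> c X Y Z c0; rewrite /V /= !absvM mulrCA ltr_pM2l // absv_gt0.
have nV : \forall Q \near P, V (@hcoords K E Q).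
  by apply: nbhs_vpoint => //; rewrite /hcoords cP /V /= absv0 absv1 mulr1.
apply: filterS nV => Q; rewrite /V /inv_x /hcoords subr0.
case: Q => -[[x' y']|] hQ /=; last by rewrite absv0.
rewrite absv1 => h.
have y'C : C < v y'.
  move: h; rewrite mulrC ltr_pdivlMr ?ltr_wpDl // mul1r.
  by apply: le_lt_trans; rewrite (le_trans (ler_norm C)) // lerDl.
have x'd : d^-1 < v x'.
  by rewrite ltNge; apply/negP => /(CP _ _ hQ); rewrite leNgt y'C.
by rewrite absvV invf_plt // posrE ?(lt_trans _ x'd) ?invr_gt0.
Qed.

(** Conversely [x] large forces [x / y] and [1 / y] to be small, since [y ^ 2] is
    comparable with [x ^ 3]. *)
Lemma nbhs_ptO (R : realType) (K : fieldType) (v : absval R K)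
    (E : ellcurve K) (U : set (vpoint v E)) :
  nbhs (ptO E : vpoint v E) U ->
  exists2 B : R, 0 < B & forall P : vpoint v E,
    P = ptO E \/ B < v (xcoord P) -> U P.
Proof.
rewrite nbhsE => -[W [[V [oV sV WE]] WO] WU].
have V0 : V ((0 : K), (1 : K), (0 : K)) by move: WO; rewrite WE.
have : nbhs (((0 : valued v), (1 : K) : valued v), (0 : valued v)) V.
  exact: open_nbhs_nbhs.
move=> [[A1 A2] [[[B1 B2] [nB1 nB2] hB] nA2] hA].
have [e1 e10 he1] := (vnbhsP _ _).1 nB1.
have [e2 e20 he2] := (vnbhsP _ _).1 nB2.
have [e3 e30 he3] := (vnbhsP _ _).1 nA2.
pose e := Num.min e1 e3; have e0 : 0 < e by rewrite lt_min e10.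
have hV x z : v x < e -> v z < e -> V (x, (1 : K), z).
  rewrite !lt_min => /andP[xe1 _] /andP[_ ze3]; apply: hA; split => /=.
    apply: hB; split => /=; first by apply: he1; rewrite subr0.
    by apply: he2; rewrite subrr absv0.
  by apply: he3; rewrite subr0.
pose f := e^-1; have f0 : 0 < f by rewrite invr_gt0.
(* If [|y| <= f |x|] and [|x| >= 1] then every term of the equation but [x ^ 3]
   is at most a constant times [|x| ^ 2], and [S] is the sum of the constants. *)
pose S := v (a2 E) + v (a4 E) + v (a6 E) + f ^+ 2 + v (a1 E) * f + v (a3 E) * f.
have S0 : 0 <= S by rewrite !addr_ge0 ?mulr_ge0 ?exprn_ge0 ?absv_ge0 // ltW.
exists (S + 1) => [|P]; first by lra.
case=> [->|]; first exact: WU.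
case: P => -[[x y]|] hP; rewrite /xcoord /=; last by rewrite absv0; lra.
move=> xS; apply: WU; rewrite WE /= /hcoords /=.
have yx : f * v x < v y.
  rewrite ltNge; apply/negP => yx.
  have := hP => /eqP h.
  have e3x : x ^+ 3 = y ^+ 2 + a1 E * x * y + a3 E * y
     - (a2 E * x ^+ 2 + a4 E * x + a6 E) by rewrite h; ring.
  have le3 : v x ^+ 3 <= v y ^+ 2 + v (a1 E) * v x * v y + v (a3 E) * v y
     + (v (a2 E) * v x ^+ 2 + v (a4 E) * v x + v (a6 E)).
    rewrite -!absvX e3x -!absvM (le_trans (absvB _ _ _)) //.
    by rewrite lerD // (le_trans (absvD _ _ _)) // lerD // absvD.
  have x1 : 1 <= v x by lra.
  have y0 := absv_ge0 v y.
  have t1 : v y ^+ 2 <= f ^+ 2 * v x ^+ 2 by rewrite -exprMn lerXn2r ?nnegrE //; lra.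
  have t2 : v (a1 E) * v x * v y <= v (a1 E) * f * v x ^+ 2.
    rewrite (_ : _ * f * _ = v (a1 E) * v x * (f * v x)); last by ring.
    by rewrite ler_wpM2l // mulr_ge0 ?absv_ge0.
  have xx : v x <= v x ^+ 2 by rewrite expr2 ler_peMl //; lra.
  have t3 : v (a3 E) * v y <= v (a3 E) * f * v x ^+ 2.
    rewrite -mulrA ler_wpM2l ?absv_ge0 // (le_trans yx) // ler_wpM2l //.
    exact: ltW.
  have t4 : v (a4 E) * v x <= v (a4 E) * v x ^+ 2 by rewrite ler_wpM2l ?absv_ge0.
  have t6 : v (a6 E) <= v (a6 E) * v x ^+ 2.
    by rewrite ler_peMr ?absv_ge0 //; lra.
  have : v x ^+ 3 <= S * v x ^+ 2.
    by apply: (le_trans le3); rewrite /S !mulrDl; lra.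
  by rewrite exprS ler_pM2r ?exprn_gt0 //; lra.
have vx1 : 1 < v x by lra.
have y0 : y != 0.
  by rewrite -(absv_gt0 v) (lt_trans _ yx) // mulr_gt0 //; lra.
(* Dividing by [y] brings the homogeneous coordinates close to [(0, 1, 0)]. *)
rewrite (_ : x = y * (x / y)); last by rewrite mulrCA divff ?mulr1.
rewrite -[X in (_, X, _)](mulr1 y) -[X in (_, X)](divff y0).
have vy : 0 < v y by rewrite absv_gt0.
apply: sV => //; apply: hV; rewrite ?absvM absvV.
  by rewrite ltr_pdivrMr // -ltr_pdivrMl.
rewrite invf_plt ?posrE // -/f; apply: le_lt_trans yx.
by rewrite ler_peMr // ltW.
Qed.

(** * Bounds along the subgroup *)

Ltac vcvg_tac := repeat first
  [ assumption | apply: vcvg_cst | apply: vcvgD | apply: vcvgN | apply: vcvgM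
  | apply: vcvgX ].

(** As the points [P = (x, y)] tend to [Q = (0, y0)], the slope of the line through
    [Q] and [- P] tends to infinity: if [Y(Q) != 0] its numerator tends to [- Y(Q)];
    if [Y(Q) = 0] then [- P] also tends to [Q], where the tangent is vertical. *)
Lemma slope_infty (R : realType) (K : fieldType) (v : absval R K)
    (E : ellcurve K) (x y : nat -> K) (y0 : K) :
  (forall n, oncurve E (Some (x n, y n))) -> (forall n, x n != 0) ->
  vcvg v \oo x 0 -> vcvg v \oo y y0 ->
  oncurve E (Some (0, y0)) /\
  forall C, \forall n \near \oo,
    C < v ((- y n - a1 E * x n - a3 E - y0) / x n).
Proof.
move=> hP xn0 x0 yy0.
have h0 : oncurve E (Some (0, y0)).
  rewrite /= -subr_eq0; apply/eqP.
  apply: (@vcvg_unique _ _ v _ \oo _ (fun n => y n ^+ 2 + a1 E * x n * y n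
    + a3 E * y n - (x n ^+ 3 + a2 E * x n ^+ 2 + a4 E * x n + a6 E))).
    by vcvg_tac.
  under eq_fun => n do rewrite (eqP (hP n)) subrr.
  exact: vcvg_cst.
split=> //; pose s n := (- y n - a1 E * x n - a3 E - y0) / x n.
have [Y0|Y0] := eqVneq (2 * y0 + a3 E) 0; last first.
  have d0 : - y0 - a1 E * 0 - a3 E - y0 != 0.
    by move: Y0; rewrite -oppr_eq0; congr (_ != 0); ring.
  apply: (vcvg_infty d0 x0).
  under eq_fun => n do rewrite /s divfK //.
  by vcvg_tac.
(* The numerator now tends to 0; the difference of the equations of [P] and [Q],
   divided by [x], rewrites the slope with denominator [y - y0]. *)
have c0 := nonsingular_x0 h0 Y0.
have d0 : - (0 ^+ 2 + a2 E * 0 + a4 E - a1 E * y0) != 0.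
  by move: c0; rewrite expr0n mulr0 !add0r oppr_eq0.
have r0 : vcvg v \oo (fun n => y n - y0) 0.
  by rewrite -(subrr y0); vcvg_tac.
apply: (vcvg_infty d0 r0).
under eq_fun => n.
  rewrite (_ : s n * _ = - (x n ^+ 2 + a2 E * x n + a4 E - a1 E * y0)); first over.
  apply: (mulIf (xn0 n)); rewrite mulrAC /s divfK //.
  have e1 := eqP (hP n); have e0 := eqP h0.
  transitivity (- (y n ^+ 2 + a1 E * x n * y n + a3 E * y n)
    + (y0 ^+ 2 + a1 E * 0 * y0 + a3 E * y0) + a1 E * y0 * x n).
    by ring.
  by rewrite e1 e0; ring.
by vcvg_tac.
Qed.

(** The heart of the matter: if [x] came arbitrarily close to 0 on the subgroup,
    compactness would give a limit point [Q] with [x = 0]; then [Q - P] is close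
    to 0 for [P] in the subgroup close to [Q], so that [Q = (Q - P) + P] would
    lie in the subgroup. *)
Lemma inv_x_bounded (R : realType) (K : fieldType) (v : absval R K)
    (Kloc : local_field v) (E : ellcurve K) (Gamma : set (vpoint v E))
    (Gamma_open : open Gamma) (Gamma_sub : subgroup Gamma)
    (Gamma_x : forall P, Gamma P -> P != ptO E -> xcoord P != 0) :
  exists2 M : R, 0 < M & forall P, Gamma P -> v (inv_x P) <= M.
Proof.
have [GO GD GN] := Gamma_sub.
apply: contrapT => unb.
have /choice[p pP] : forall n : nat, exists q : K * K, exists P : Defs.point E,
    [/\ Gamma P, coords P = Some q, q.1 != 0 & v q.1 < n.+1%:R^-1].
  move=> n; apply: contrapT => none; apply: unb; exists n.+1%:R => // P GP.
  rewrite leNgt; apply/negP => big; apply: none.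
  case cP : (coords P) => [[x y]|]; last first.
    by move: big; rewrite /inv_x cP absv0 ltNge ler0n.
  move: big; rewrite /inv_x cP => big; exists (x, y), P => /=.
  have x0 : x != 0.
    by apply: contraTneq big => ->; rewrite invr0 absv0 ltNge ler0n.
  split=> //; move: big; rewrite absvV => big.
  by rewrite -[v x]invrK ltf_pV2 // posrE ?invr_gt0 ?absv_gt0.
have hp n : oncurve E (Some ((p n).1, (p n).2)).
  by have [P [_ cP _ _]] := pP n; move: (coordsP P); rewrite cP -surjective_pairing.
have [C CP] := y_bounded v E 1.
have yC n : v (p n).2 <= C.
  apply: (CP _ _ (hp n)); have [_ [_ _ _ /ltW h]] := pP n.
  by apply: (le_trans h); rewrite invf_le1 // ler1n.
have [y0 [phi phik cy]] := bolzano Kloc yC.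
pose x k := (p (phi k)).1; pose y k := (p (phi k)).2.
have xs k : v (x k) < k.+1%:R^-1.
  have [_ [_ _ _ h]] := pP (phi k); apply: (lt_le_trans h).
  by rewrite lef_pV2 ?posrE // ler_nat ltnS.
have cx : vcvg v \oo x 0.
  apply: (@vcvg_le _ _ _ _ _ _ _ _ (fun k => v (x k))).
    by move=> k; rewrite subr0.
  apply: (@squeeze_cvgr _ _ _ _ (fun=> 0) harmonic); last exact: cvg_harmonic.
    by apply: nearW => k; rewrite absv_ge0 /= ltW.
  exact: cvg_cst.
have xn0 k : x k != 0 by have [_ [_ _ h _]] := pP (phi k).
have hxy k : oncurve E (Some (x k, y k)) by exact: hp.
have [h0 hs] := slope_infty hxy xn0 cx cy.
pose Q := Point h0.
have [B B0 BP] : exists2 B : R, 0 < B & forall P : vpoint v E,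
    P = ptO E \/ B < v (xcoord P) -> Gamma P.
  by apply: nbhs_ptO; exact: open_nbhs_nbhs.
(* [x(R)] is [s ^ 2 + a1 s - a2 - x], so this bound on the slope [s] puts
   [R = Q - P] in the neighbourhood of infinity that [B] describes. *)
have [k _ /(_ k (leqnn k)) /= ks] := hs (v (a1 E) + v (a2 E) + B + 2).
have [P [GP cP _ _]] := pP (phi k).
have cP' : coords P = Some (x k, y k) by rewrite cP /x /y -surjective_pairing.
have := add_recover cP' (erefl : coords Q = Some (0, y0)) (xn0 k).
cbv zeta; set s := _ / x k in ks *; set u := _ - x k => -[xR RO RP].
have x1 : v (x k) < 1.
  by apply: (lt_le_trans (xs k)); rewrite invf_le1 // ler1n.
have uB : B + 1 < v u.
  have e : s ^+ 2 = u - a1 E * s + (a2 E + x k) by rewrite /u; ring.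
  have : v s ^+ 2 <= v u + v (a1 E) * v s + (v (a2 E) + v (x k)).
    rewrite -absvX e (le_trans (absvD _ _ _)) // lerD ?absvD //.
    by rewrite (le_trans (absvB _ _ _)) // absvM.
  have := absv_ge0 v (a1 E); have := absv_ge0 v (a2 E).
  move: ks x1 B0; move: (v s) (v u) (v (a1 E)) (v (a2 E)) (v (x k)) => S U A1 A2 X.
  nra.
have GR : Gamma (pt_add Q (pt_opp P)) by apply: BP; right; rewrite xR; lra.
have GQ : Gamma Q.
  rewrite -RP; first exact: GD.
  by apply: contraTneq uB => ->; rewrite -leNgt; lra.
have := Gamma_x _ GQ isT.
by rewrite /xcoord eqxx.
Qed.

Lemma Zpoly_horner (K : fieldType) (E : ellcurve K) (t : K) :
  Zpoly E t = (1 - (b4 E)%:P * 'X^2 - (2 * b6 E)%:P * 'X^3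
    - (b8 E)%:P * 'X^4).[t].
Proof. by rewrite /Zpoly !hornerE. Qed.

Lemma Wpoly_horner (K : fieldType) (E : ellcurve K) (t : K) :
  Wpoly E t = ((4 : K)%:P * 'X + (b2 E)%:P * 'X^2 + (2 * b4 E)%:P * 'X^3
    + (b6 E)%:P * 'X^4).[t].
Proof. by rewrite /Wpoly !hornerE. Qed.

(** Since [W] and [Z] have no common zero, [Z] can only be small where [W / Z] is
    large. *)
Lemma Zpoly_lower_bound (R : realType) (K : fieldType) (v : absval R K)
    (E : ellcurve K) (M : R) :
  0 < M -> exists2 eps : R, 0 < eps & forall t,
    v t <= M -> v (Wpoly E t) <= M * v (Zpoly E t) -> eps <= v (Zpoly E t).
Proof.
move=> M0.
have [A hA] : exists A, forall t, v t <= M ->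
    v (t * (48 + 8 * b2 E * t + (32 * b4 E - b2 E ^+ 2) * t ^+ 2)) <= A.
  apply: (@horner_bounded _ _ v ('X * ((48 : K)%:P + (8 * b2 E)%:P * 'X
    + (32 * b4 E - b2 E ^+ 2)%:P * 'X^2))) => t; by rewrite !hornerE.
have [B hB] : exists B, forall t, v t <= M ->
    v (12 - b2 E * t - 10 * b4 E * t ^+ 2
       + (b2 E * b4 E - 27 * b6 E) * t ^+ 3) <= B.
  apply: (@horner_bounded _ _ v ((12 : K)%:P - (b2 E)%:P * 'X
    - (10 * b4 E)%:P * 'X^2 + (b2 E * b4 E - 27 * b6 E)%:P * 'X^3)) => t.
  by rewrite !hornerE.
have [H hH] : exists H, forall t, v t <= M ->
    v (b4 E * t + 2 * b6 E * t ^+ 2 + b8 E * t ^+ 3) <= H.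
  apply: (@horner_bounded _ _ v ((b4 E)%:P * 'X + (2 * b6 E)%:P * 'X^2
    + (b8 E)%:P * 'X^3)) => t; by rewrite !hornerE.
have ge0 f c : (forall t, v t <= M -> v (f t) <= c) -> 0 <= c.
  by move=> /(_ 0); rewrite absv0 => /(_ (ltW M0)); apply: le_trans; exact: absv_ge0.
have A0 := ge0 _ _ hA; have B0 := ge0 _ _ hB; have H0 := ge0 _ _ hH.
set D := wdisc (a1 E) (a2 E) (a3 E) (a4 E) (a6 E).
have D0 : 0 < v D by rewrite absv_gt0 wdisc_neq0.
(* From [1 = Z + t (...)] with the factor bounded by [H], either [|Z| >= 1 / 2]
   or [|t| >= tau]; in the second case the Bezout identity bounds [Z] below. *)
pose tau := (2 * H + 1)^-1; have tau0 : 0 < tau by rewrite invr_gt0; lra.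
have S0 : 0 < A + B * M + 1 by rewrite ltr_wpDl // addr_ge0 // mulr_ge0 // ltW.
exists (Num.min (1 / 2) (v D * tau ^+ 7 / (A + B * M + 1))).
  by rewrite lt_min divr_gt0 //= divr_gt0 // mulr_gt0 // exprn_gt0.
move=> t tM WZ; rewrite ge_min; have [//|Z2 /=] := leP (1 / 2) (v (Zpoly E t)).
have ttau : tau <= v t.
  have : v 1 <= v (Zpoly E t) + v t * H.
    have {1}-> : 1 = Zpoly E t + t * (b4 E * t + 2 * b6 E * t ^+ 2 + b8 E * t ^+ 3).
      by rewrite /Zpoly; ring.
    rewrite (le_trans (absvD _ _ _)) // lerD2l absvM ler_wpM2l ?absv_ge0 //.
    exact: hH.
  rewrite absv1 => h; rewrite invf_ple ?posrE //; try lra.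
    rewrite -[_^-1]mul1r ler_pdivrMr; nra.
  nra.
have t7 : v D * tau ^+ 7 <= v D * v t ^+ 7.
  by rewrite ler_wpM2l ?absv_ge0 // lerXn2r ?nnegrE ?absv_ge0 // ltW.
rewrite ler_pdivrMr //; apply: (le_trans t7).
rewrite -absvX -absvM -absvN -mulNr -(bezout_WZ E t).
rewrite (le_trans (absvB _ _ _)) // !absvM.
have Zt := absv_ge0 v (Zpoly E t).
apply: (@le_trans _ _ (A * v (Zpoly E t) + B * (M * v (Zpoly E t)))).
  apply: lerD; first by rewrite ler_wpM2r // -absvM hA.
  by rewrite ler_pM ?absv_ge0 ?hB.
nra.
Qed.

(** * The local height *)

(** Adding or subtracting [2 * C / 4 ^ N] turns the partial sums into a
    nonincreasing or a nondecreasing sequence with the same limit. *)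
Lemma series_tail (R : realType) (u : nat -> R) (C : R) :
  (forall n, `|u n| <= C / 4 ^+ n) ->
  cvgn (series u) /\
  forall N, `|limn (series u) - series u N| <= 2 * C / 4 ^+ N.
Proof.
move=> uC.
have C0 : 0 <= C by have := uC 0%N; rewrite expr0 divr1; apply: le_trans.
have quarter : 4^-1 < 1 :> R by rewrite invf_lt1 ?ltr0n // ltr1n.
have cu : cvgn (series u).
  apply: normed_cvg; apply: (@series_le_cvg R _ (geometric C 4^-1)) => [n|n|n|].
  - exact: normr_ge0.
  - by rewrite /= mulr_ge0 // exprn_ge0 // invr_ge0.
  - by rewrite /= exprVn.
  - by apply: is_cvg_geometric_series; rewrite ger0_norm // invr_ge0.
split=> // N.
pose r n : R := 2 * C / 4 ^+ n.
have r0 : r @ \oo --> (0 : R).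
  have := @cvg_geometric R (2 * C) 4^-1; rewrite ger0_norm ?invr_ge0 // => /(_ quarter).
  by rewrite /geometric /=; under eq_fun do rewrite exprVn.
have step n : r n.+1 = r n / 4.
  by rewrite /r exprS invfM mulrA mulrAC.
have un n : `|u n| <= r n / 2.
  by apply: (le_trans (uC n)); rewrite /r; lra.
have r_ge0 n : 0 <= r n by rewrite /r divr_ge0 ?mulr_ge0 ?exprn_ge0.
have up : limn (series u) <= series u N + r N.
  have c : (fun n => series u n + r n) @ \oo --> limn (series u).
    by rewrite -[X in _ --> X]addr0; exact: cvgD.
  rewrite -(cvg_lim _ c) //; apply: (nonincreasing_cvgn_ge _ (cvgP _ c)).
  apply/nonincreasing_seqP => n; rewrite seriesSr step.
  by have := un n; have := r_ge0 n; rewrite ler_norml => ? /andP[_]; lra.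
have down : series u N - r N <= limn (series u).
  have c : (fun n => series u n - r n) @ \oo --> limn (series u).
    by rewrite -[X in _ --> X]subr0; exact: cvgB.
  rewrite -(cvg_lim _ c) //; apply: (nondecreasing_cvgn_le _ (cvgP _ c)).
  apply/nondecreasing_seqP => n; rewrite seriesSr step.
  by have := un n; have := r_ge0 n; rewrite ler_norml => ? /andP[]; lra.
by rewrite -/(r N) ler_norml; apply/andP; split; lra.
Qed.

Lemma tseq_double (R : realType) (K : fieldType) (v : absval R K)
    (E : ellcurve K) (Gamma : set (vpoint v E)) (Gamma_sub : subgroup Gamma)
    (Gamma_x : forall P, Gamma P -> P != ptO E -> xcoord P != 0)
    (P : vpoint v E) (n : nat) :
  Gamma P -> tseq (pt_add P P) n = tseq P n.+1.
Proof.
have [_ GD _] := Gamma_sub.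
move=> GP; elim: n => [|n IH] /=; last by rewrite IH.
have GPP := GD _ _ GP GP.
by have [] := inv_x_double (Gamma_x P GP) (Gamma_x _ GPP).
Qed.

(** The sequence follows [1 / x] along the points [2 ^ n P]. *)
Lemma tseq_inv_x (R : realType) (K : fieldType) (v : absval R K)
    (E : ellcurve K) (Gamma : set (vpoint v E)) (Gamma_sub : subgroup Gamma)
    (Gamma_x : forall P, Gamma P -> P != ptO E -> xcoord P != 0)
    (P : vpoint v E) (n : nat) :
  Gamma P -> exists2 Q, Gamma Q & tseq P n = inv_x Q.
Proof.
have [_ GD _] := Gamma_sub.
elim: n P => [|n IH] P GP; first by exists P.
have [Q GQ eQ] := IH (pt_add P P) (GD _ _ GP GP).
by exists Q => //; rewrite -eQ (tseq_double Gamma_sub Gamma_x).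
Qed.

Lemma Zseq_neq0 (R : realType) (K : fieldType) (v : absval R K)
    (E : ellcurve K) (Gamma : set (vpoint v E)) (Gamma_sub : subgroup Gamma)
    (Gamma_x : forall P, Gamma P -> P != ptO E -> xcoord P != 0)
    (P : vpoint v E) (n : nat) :
  Gamma P -> Zseq P n != 0.
Proof.
have [_ GD _] := Gamma_sub.
move=> GP; have [Q GQ eQ] := tseq_inv_x Gamma_sub Gamma_x n GP.
rewrite /Zseq eQ; have GQQ := GD _ _ GQ GQ.
by have [] := inv_x_double (Gamma_x Q GQ) (Gamma_x _ GQQ).
Qed.

Lemma vcvg_Wpoly (R : realType) (K : fieldType) (v : absval R K) (T : Type)
    (F : set_system T) {FF : Filter F} (E : ellcurve K) (t : T -> K) (a : K) :
  vcvg v F t a -> vcvg v F (fun x => Wpoly E (t x)) (Wpoly E a).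
Proof.
move=> ta; rewrite Wpoly_horner; under eq_fun do rewrite Wpoly_horner.
exact: vcvg_horner.
Qed.

Lemma vcvg_Zpoly (R : realType) (K : fieldType) (v : absval R K) (T : Type)
    (F : set_system T) {FF : Filter F} (E : ellcurve K) (t : T -> K) (a : K) :
  vcvg v F t a -> vcvg v F (fun x => Zpoly E (t x)) (Zpoly E a).
Proof.
move=> ta; rewrite Zpoly_horner; under eq_fun do rewrite Zpoly_horner.
exact: vcvg_horner.
Qed.

Lemma tseq_continuous (R : realType) (K : fieldType) (v : absval R K)
    (E : ellcurve K) (Gamma : set (vpoint v E)) (Gamma_sub : subgroup Gamma)
    (Gamma_x : forall P, Gamma P -> P != ptO E -> xcoord P != 0)
    (P : vpoint v E) (n : nat) :
  Gamma P ->
  vcvg v (nbhs P) (fun Q : vpoint v E => tseq Q n) (tseq P n) /\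
  vcvg v (nbhs P) (fun Q : vpoint v E => Zseq Q n) (Zseq P n).
Proof.
move=> GP.
suff t : vcvg v (nbhs P) (fun Q : vpoint v E => tseq Q n) (tseq P n).
  by split=> //; exact: (vcvg_Zpoly E t).
elim: n => [|n IH]; first exact: inv_x_continuous (Gamma_x P GP).
have Z0 := Zseq_neq0 Gamma_sub Gamma_x n GP.
exact: (vcvgM (vcvg_Wpoly E IH) (vcvgV Z0 (vcvg_Zpoly E IH))).
Qed.

(** The terms are continuous and the series converges uniformly. *)
Lemma mu_continuous (R : realType) (K : fieldType) (v : absval R K)
    (E : ellcurve K) (Gamma : set (vpoint v E)) (Gamma_open : open Gamma)
    (Gamma_sub : subgroup Gamma)
    (Gamma_x : forall P, Gamma P -> P != ptO E -> xcoord P != 0)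
    (C : R) (muC : forall P n, Gamma P -> `|@mu_term R K v E P n| <= C / 4 ^+ n)
    (P : vpoint v E) :
  Gamma P -> {for P, continuous (@mu R K v E)}.
Proof.
move=> GP; have FP : Filter (nbhs P) by exact: nbhs_filter.
apply/cvgrPdist_lt => e e0.
have C0 : 0 <= C by have := muC P 0%N GP; rewrite expr0 divr1; apply: le_trans.
have term n : mu_term Q n @[Q --> P] --> mu_term P n.
  apply: cvgM; last exact: cvg_cst.
  apply: continuous_cvg; last first.
    by apply: vcvg_absv; have [] := tseq_continuous Gamma_sub Gamma_x n GP.
  by apply: continuous_ln; rewrite absv_gt0 (Zseq_neq0 Gamma_sub Gamma_x).
have partial N : series (mu_term Q) N @[Q --> P] --> series (mu_term P) N.
  elim: N => [|N IH].
    by rewrite /series /= big_geq //; under eq_fun do rewrite big_geq //; exact: cvg_cst.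
  by rewrite seriesSr; under eq_fun do rewrite seriesSr; exact: cvgD.
have [N NC] : exists N, 2 * C / 4 ^+ N < e / 3.
  have : geometric (2 * C) (4^-1 : R) n @[n --> \oo] --> 0.
    by apply: cvg_geometric; rewrite ger0_norm ?invr_ge0 // invf_lt1 ?ltr0n // ltr1n.
  move/cvgr_lt => /(_ (e / 3)); rewrite divr_gt0 // => /(_ isT) [N _].
  by move=> /(_ N (leqnn N)) /=; rewrite exprVn; exists N.
have e3 : 0 < e / 3 by rewrite divr_gt0.
have nearP : \forall Q \near P, `|series (mu_term P) N - series (mu_term Q) N| < e / 3.
  by have /cvgrPdist_lt := partial N; exact.
have nearG : \forall Q \near P, Gamma Q by exact: open_nbhs_nbhs.
near=> Q.
have GQ : Gamma Q by near: Q.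
have h : `|series (mu_term P) N - series (mu_term Q) N| < e / 3 by near: Q.
have [_ /(_ N) hP] := series_tail (fun n => muC P n GP).
have [_ /(_ N) hQ] := series_tail (fun n => muC Q n GQ).
move: hP hQ h NC; rewrite -/(mu P) -/(mu Q).
move: (mu P) (mu Q) (series (mu_term P) N) (series (mu_term Q) N) => a b c d.
rewrite !ler_norml !ltr_norml => /andP[? ?] /andP[? ?] /andP[? ?] ?.
by apply/andP; split; lra.
Unshelve. all: by end_near. Qed.

(** Doubling shifts the sequence, hence multiplies the series by 4 once its first
    term is removed. *)
Lemma mu_double (R : realType) (K : fieldType) (v : absval R K)
    (E : ellcurve K) (Gamma : set (vpoint v E)) (Gamma_sub : subgroup Gamma)
    (Gamma_x : forall P, Gamma P -> P != ptO E -> xcoord P != 0)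
    (P : vpoint v E) :
  Gamma P -> cvgn (series (mu_term P)) ->
  mu (pt_add P P : vpoint v E) = 4 * (mu P - ln (v (Zpoly E (inv_x P)))).
Proof.
move=> GP cP; set Q := pt_add P P : vpoint v E.
have step n : mu_term Q n = 4 * mu_term P n.+1.
  rewrite /mu_term /Zseq (tseq_double Gamma_sub Gamma_x) // exprS invfM.
  by rewrite mulrCA !mulrA mulrK ?unitfE.
have sumE n : series (mu_term Q) n
    = 4 * (series (mu_term P) n.+1 - ln (v (Zpoly E (inv_x P)))).
  elim: n => [|n IH]; last by rewrite seriesSr IH step (seriesSr _ n.+1); ring.
  by rewrite /series /= big_geq // big_nat1 /mu_term expr0 divr1 subrr mulr0.
apply: cvg_lim => //; rewrite (_ : series (mu_term Q) =
  fun n => 4 * (series (mu_term P) n.+1 - ln (v (Zpoly E (inv_x P))))); last first.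
  exact/funext.
apply: cvgM; first exact: cvg_cst.
apply: cvgB; last exact: cvg_cst.
by rewrite (cvg_shiftS (series (mu_term P))).
Qed.

Lemma mu_ptO (R : realType) (K : fieldType) (v : absval R K) (E : ellcurve K) :
  mu (ptO E : vpoint v E) = 0.
Proof.
have t0 n : tseq (ptO E) n = 0.
  by elim: n => //= n ->; rewrite /Wpoly !expr0n /= !mulr0 !addr0 mul0r.
rewrite /mu (_ : series _ = fun=> 0); first exact: lim_cst.
apply/funext => n; rewrite /series /= big1 // => i _.
by rewrite /mu_term /Zseq t0 /Zpoly !expr0n /= !mulr0 !subr0 absv1 ln1 mul0r.
Qed.

(** This form exhibits [lambda] as a combination of continuous functions. *)
Lemma lambda_invx (R : realType) (K : fieldType) (v : absval R K)
    (E : ellcurve K) (P : vpoint v E) :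
  xcoord P != 0 -> lambda P = mu P / 8 - ln (v (inv_x P)) / 2.
Proof.
move=> x0; have -> : inv_x P = (xcoord P)^-1.
  by rewrite /inv_x /xcoord; case: (coords _) => [[x y]|] //; rewrite invr0.
by rewrite absvV lnV ?posrE ?absv_gt0 // /lambda; ring.
Qed.

Theorem mainTheorem1 (R : realType) (K : fieldType) (v : absval R K)
    (Kloc : local_field v) (E : ellcurve K) (Gamma : set (vpoint v E))
    (Gamma_open : open Gamma) (Gamma_sub : subgroup Gamma)
    (Gamma_x : forall P, Gamma P -> P != ptO E -> xcoord P != 0) :
  (exists eps M : R, 0 < eps /\
     forall P, Gamma P -> forall n, v (tseq P n) <= M /\ eps <= v (Zseq P n)) /\
  (exists N : R, forall P, Gamma P -> forall n, ln (v (Zseq P n)) <= N) /\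
  (forall P, Gamma P -> cvgn (series (@mu_term R K v E P))) /\
  {within Gamma `\ ptO E, continuous (@lambda R K v E)} /\
  (forall U : set (vpoint v E), nbhs (ptO E : vpoint v E) U ->
     exists B : R, forall P, Gamma P -> ~ U P -> `|lambda P| <= B) /\
  (lambda P - ln (v (xcoord P)) / 2
     @[P --> within (Gamma `\ ptO E) (nbhs (ptO E : vpoint v E))] --> (0 : R)) /\
  (forall P : vpoint v E, Gamma P -> pt_add P P != ptO E ->
     lambda (pt_add P P : vpoint v E)
       = 4 * lambda P - ln (v (Ycoord P))).
Proof.
have [GO GD GN] := Gamma_sub.
have [M M0 invM] := inv_x_bounded Kloc Gamma_open Gamma_sub Gamma_x.
have tM P n : Gamma P -> v (tseq P n) <= M.
  by move=> /(tseq_inv_x Gamma_sub Gamma_x n)[Q GQ ->]; exact: invM.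
have Zn0 P n : Gamma P -> Zseq P n != 0 by exact: Zseq_neq0.
have [eps eps0 epsZ] := Zpoly_lower_bound v E M0.
have Zeps P n : Gamma P -> eps <= v (Zseq P n).
  move=> GP; apply: epsZ; first exact: tM.
  have := tM P n.+1 GP; rewrite /= absvM absvV ler_pdivrMr //.
  by rewrite absv_gt0; exact: Zn0.
have [B hB] : exists B, forall t, v t <= M -> v (Zpoly E t) <= B.
  by apply: horner_bounded => t; rewrite Zpoly_horner.
have Zpos P n : Gamma P -> 0 < v (Zseq P n) by move=> GP; rewrite absv_gt0 Zn0.
have lnB P n : Gamma P -> ln (v (Zseq P n)) <= ln B.
  move=> GP; have ZB := hB _ (tM P n GP).
  by rewrite ler_ln ?posrE ?Zpos // (lt_le_trans (Zpos P n GP)).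
have lneps P n : Gamma P -> ln eps <= ln (v (Zseq P n)).
  by move=> GP; rewrite ler_ln ?posrE ?Zpos ?Zeps.
pose C := `|ln B| + `|ln eps|.
have muC P n : Gamma P -> `|@mu_term R K v E P n| <= C / 4 ^+ n.
  move=> GP; rewrite normrM normfV normrX (ger0_norm (ler0n _ 4)) ler_pM2r ?invr_gt0 ?exprn_gt0 //.
  rewrite ler_norml; apply/andP; split.
    apply: le_trans (lneps P n GP); rewrite /C.
    by have := lerNnormlW (lexx `|ln eps|); have := normr_ge0 (ln B); lra.
  apply: le_trans (lnB P n GP) _; rewrite /C.
  by have := ler_norm (ln B); have := normr_ge0 (ln eps); lra.
have mu_bound P : Gamma P -> `|mu P| <= 2 * C.
  move=> GP; have [_ /(_ 0%N)] := series_tail (fun n => muC P n GP).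
  by rewrite /series /= big_geq // subr0 expr0 divr1.
have mu_cont P : Gamma P -> {for P, continuous (@mu R K v E)}.
  by move=> GP; exact: (mu_continuous Gamma_open Gamma_sub Gamma_x muC).
split; first by exists eps, M; split=> // P GP n; split; [exact: tM | exact: Zeps].
split; first by exists (ln B) => P GP n; exact: lnB.
split; first by move=> P GP; have [] := series_tail (fun n => muC P n GP).
have tx P : Gamma P -> P != ptO E -> inv_x P != 0.
  move=> GP PO; have := Gamma_x P GP PO; rewrite /xcoord /inv_x.
  by case: (coords _) => [[x y]|]; rewrite ?eqxx // invr_eq0.
split.
  apply: continuous_in_subspaceT => P; rewrite inE => -[GP /eqP PO].
  have x0 := Gamma_x P GP PO; have t0 := tx P GP PO.
  have FP : Filter (nbhs P) by exact: nbhs_filter.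
  have ct := inv_x_continuous (Gamma_x P GP).
  have nx : \forall Q \near P, xcoord (Q : vpoint v E) != 0.
    have : \forall Q \near P, 0 < v (inv_x (Q : vpoint v E)).
      by apply: (cvgr_gt _ (vcvg_absv ct)); rewrite absv_gt0.
    apply: filterS => Q; rewrite absv_gt0 /inv_x /xcoord.
    by case: (coords _) => [[x y]|]; rewrite ?eqxx // invr_eq0.
  have nG : \forall Q \near P, mu Q / 8 - ln (v (inv_x (Q : vpoint v E))) / 2 = lambda Q.
    by apply: filterS nx => Q Qx; rewrite lambda_invx.
  rewrite /continuous_at lambda_invx //; apply: cvg_trans (near_eq_cvg nG) _.
  apply: cvgB; apply: cvgM; [exact: mu_cont | exact: cvg_cst | | exact: cvg_cst].
  apply: continuous_cvg; last exact: vcvg_absv.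
  by apply: continuous_ln; rewrite absv_gt0.
split.
  move=> U nU; have [S S0 US] := nbhs_ptO nU.
  exists (`|ln S| + `|ln M| + 2 * C) => P GP nUP.
  have PO : P != ptO E by apply/eqP => e; apply: nUP; apply: US; left.
  have x0 := Gamma_x P GP PO.
  have xS : v (xcoord P) <= S.
    by rewrite leNgt; apply/negP => h; apply: nUP; apply: US; right.
  have xM : M^-1 <= v (xcoord P).
    rewrite invf_ple ?posrE ?absv_gt0 // -absvV.
    have := invM P GP; rewrite /inv_x /xcoord.
    by case: (coords _) => [[x y]|] //; rewrite invr0.
  have l1 : ln (v (xcoord P)) <= ln S by rewrite ler_ln ?posrE ?absv_gt0.
  have l2 : - ln M <= ln (v (xcoord P)).
    by rewrite -lnV ?posrE // ler_ln ?posrE ?invr_gt0 ?absv_gt0.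
  have := mu_bound P GP; rewrite /lambda.
  have := ler_norm (ln S); have := ler_norm (ln M).
  have := normr_ge0 (ln S); have := normr_ge0 (ln M).
  rewrite !ler_norml => ? ? ? ? /andP[? ?]; apply/andP; split; lra.
split.
  rewrite (_ : (fun P => _) = fun P : vpoint v E => mu P / 8); last first.
    by apply/funext => P; rewrite /lambda addrAC subrr add0r.
  have FO : Filter (nbhs (ptO E : vpoint v E)) by exact: nbhs_filter.
  have h : mu P / 8 @[P --> (ptO E : vpoint v E)] --> mu (ptO E : vpoint v E) / 8.
    by apply: cvgM; [exact: mu_cont | exact: cvg_cst].
  by rewrite mu_ptO mul0r in h; exact: cvg_within_filter h.
move=> P GP PPO.
have cP : cvgn (series (mu_term P)) by have [] := series_tail (fun n => muC P n GP).
have PO : P != ptO E by apply: contraNneq PPO => ->; apply/eqP/val_inj.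
have GPP := GD _ _ GP GP.
have [Z0 eT] := inv_x_double (Gamma_x P GP) (Gamma_x _ GPP).
have x0 := Gamma_x P GP PO.
have t1 := tx _ GPP PPO.
rewrite lambda_invx ?Gamma_x // (mu_double Gamma_sub Gamma_x) // /lambda eT.
have W0 : Wpoly E (inv_x P) != 0.
  by apply: contraNneq t1 => W0; rewrite eT W0 mul0r.
have : v (Wpoly E (inv_x P)) = v (Ycoord P) ^+ 2 / v (xcoord P) ^+ 4.
  have := coordsP P; move: x0; rewrite /inv_x /xcoord /Ycoord.
  case: (coords _) => [[x y]|]; last by rewrite eqxx.
  by move=> x0 /Wpoly_invx -> //; rewrite absvM absvV !absvX.
have Y0 : Ycoord P != 0.
  apply: contraNneq W0 => Y0; move: Y0 (coordsP P) x0.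
  rewrite /inv_x /xcoord /Ycoord.
  case: (coords _) => [[x y]|]; last by rewrite eqxx.
  by move=> Y0 /Wpoly_invx h /h ->; rewrite Y0 expr0n mul0r.
move=> eW; rewrite absvM absvV eW !ln_div ?lnXn ?posrE ?divr_gt0 ?exprn_gt0 ?absv_gt0 //.
rewrite -(mulr_natl _ 2) -(mulr_natl _ 4).
by field.
Qed.
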